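(* Let $G=(V,E)$ be a connected finite simple graph and let $e\in E$. Then $$\gamma_{st}(G)\leq \gamma_{st}(G_e)\leq \gamma_{st}(G)+1.$$
   Context: For a finite simple graph $G$, a set $D\subseteq V(G)$ is a strong dominating set of $G$ if for every vertex $x\in V(G)\setminus D$ there is a vertex $y\in D$ with $xy\in E(G)$ and $\deg(x)\leq\deg(y)$ (degrees taken in $G$). The strong domination number $\gamma_{st}(G)$ is the minimum cardinality of a strong dominating set of $G$. For an edge $e=\{u,v\}$ of $G$, $G_e$ denotes the graph obtained by subdividing $e$: delete the edge $\{u,v\}$, add a new vertex $w$, and add the two edges $\{u,w\}$ and $\{w,v\}$. *)

(* Defs.v *)
From mathcomp Require Import all_boot.

Set Implicit Arguments.
Unset Strict Implicit.
Unset Printing Implicit Defensive.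

Record sgraph := SGraph {
  vertex :> finType;
  adj : rel vertex;
  adj_sym : symmetric adj;
  adj_irr : irreflexive adj }.

Definition edges (G : sgraph) : {set {set G}} :=
  [set [set p.1; p.2] | p : G * G & adj p.1 p.2].

Definition connected (G : sgraph) : Prop :=
  forall x y : G, connect (@adj G) x y.

Definition deg (G : sgraph) (x : G) : nat := #|[set y | adj x y]|.

Definition strong_dominating (G : sgraph) (D : {set G}) : bool :=
  [forall (x | x \notin D), exists y in D, adj x y && (deg x <= deg y)].

Lemma strong_dominatingT (G : sgraph) : strong_dominating [set: G].
Proof. by apply/forall_inP => x; rewrite inE. Qed.

(* By strong_dominatingT, the default [set: G] satisfies the predicate being
   minimized over, so this is a genuine minimum. *)
Definition gamma_st (G : sgraph) : nat :=
  #|[arg min_(D < [set: G] | strong_dominating D) #|D|]|.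

(* The vertices of the subdivided graph are Some x for the old vertices x, and
   None for the new vertex, whose neighbours are the two endpoints of e. *)
Section Subdivision.
Variables (G : sgraph) (e : {set G}).

Definition subdiv_adj : rel (option G) := fun a b =>
  match a, b with
  | Some x, Some y => adj x y && ([set x; y] != e)
  | Some x, None => x \in e
  | None, Some y => y \in e
  | None, None => false
  end.

Lemma subdiv_adj_sym : symmetric subdiv_adj.
Proof. by case=> [x|] [y|] //=; rewrite adj_sym setUC. Qed.

Lemma subdiv_adj_irr : irreflexive subdiv_adj.
Proof. by case=> [x|] //=; rewrite adj_irr. Qed.

Definition subdivide : sgraph := SGraph subdiv_adj_sym subdiv_adj_irr.

End Subdivision.

(* Main.v *)
Require Import Defs.
From mathcomp Require Import all_boot.

(** Subdividing an edge [e] keeps the degree of every old vertex, since the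
    lost neighbour is replaced by the new vertex [w], and [w] has degree 2.
    So an old edge other than [e] dominates in the subdivided graph exactly
    when it does in [G]: a strong dominating set can be transported between the
    two graphs, and only domination along [e] or through [w] needs a repair by
    one vertex.

    Lower bound.  Let [D] be strong dominating in the subdivided graph.  If
    [w] is not in [D], then [D] is strong dominating in [G].  If [w] is in
    [D], trade it for the endpoint [v] of [e] of larger degree: the only old
    vertices that [w] could dominate are [v], now in the set, and the other
    endpoint, now dominated by [v] along [e].  The cardinality does not grow.

    Upper bound.  Let [D] be strong dominating in [G].  If every endpoint of
    [e] that lies in [D] has degree at most 2, then so has every endpoint that
    [D] dominates along [e], so [w] can take over and adding [w] works.
    Otherwise some endpoint [y] in [D] has degree more than 2; it dominates
    [w], and adding the other endpoint removes the need for [e]. *)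

Set Implicit Arguments.
Unset Strict Implicit.
Unset Printing Implicit Defensive.

Lemma strong_dominatingP (G : sgraph) (D : {set G}) :
  reflect (forall x, x \notin D ->
             exists y, [/\ y \in D, adj x y & deg x <= deg y])
          (strong_dominating D).
Proof.
apply: (iffP forall_inP) => domD x /domD.
  by case/exists_inP=> y yD /andP[xy le_xy]; exists y.
by case=> y [yD xy le_xy]; apply/exists_inP; exists y; rewrite ?xy.
Qed.

Lemma gamma_st_le (G : sgraph) (D : {set G}) :
  strong_dominating D -> gamma_st G <= #|D|.
Proof.
rewrite /gamma_st; case: arg_minnP => [|A _ minA]; last exact: minA.
exact: strong_dominatingT.
Qed.

Lemma gamma_st_attained (G : sgraph) :
  exists2 D : {set G}, strong_dominating D & #|D| = gamma_st G.
Proof.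
rewrite /gamma_st; case: arg_minnP => [|D domD _]; last by exists D.
exact: strong_dominatingT.
Qed.

Lemma edgeP (G : sgraph) (e : {set G}) :
  e \in edges G -> exists x y, adj x y /\ e = [set x; y].
Proof. by case/imsetP=> [[x y]]; rewrite inE /= => xy ->; exists x, y. Qed.

Lemma edge_deg_ordered (G : sgraph) (e : {set G}) :
  e \in edges G ->
  exists u v, [/\ adj u v, e = [set u; v] & deg u <= deg v].
Proof.
case/edgeP=> x [y [xy ->]]; case/orP: (leq_total (deg x) (deg y)) => le_deg.
  by exists x, y.
by exists y, x; rewrite adj_sym setUC.
Qed.

Lemma set2_injr (T : finType) (x y z : T) :
  [set x; y] = [set x; z] -> y = z.
Proof.
move=> eq_xyz; have: y \in [set x; z] by rewrite -eq_xyz set22.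
rewrite !inE => /orP[/eqP yx|/eqP//].
by have: z \in [set x; y] by [rewrite eq_xyz set22]; rewrite !inE yx orbb => /eqP.
Qed.

(** Redirecting the neighbour along [e] to the new vertex is a bijection from
    the old neighbourhood of [x] onto the new one. *)
Lemma deg_subdivide_old (G : sgraph) (e : {set G}) (x : G) :
  e \in edges G -> deg (Some x : subdivide e) = deg x.
Proof.
case/edgeP=> a [b [ab def_e]].
pose f y := if [set x; y] == e then None else Some y.
have f_inj : injective f.
  move=> y z; rewrite /f; case: eqP => [Ey|_]; case: eqP => [Ez|_] // eq_f.
    by apply: (@set2_injr _ x); rewrite Ey Ez.
  by case: eq_f.
rewrite /deg -(card_imset _ f_inj); apply/eq_card=> -[z|]; rewrite inE /=.
  apply/andP/imsetP=> [[xz ne_e]|[y]].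
    by exists z; rewrite ?inE // /f (negPf ne_e).
  by rewrite inE /f; case: ifP => // /negbT ne_e xy [->].
apply/idP/imsetP=> [|[y _]]; last first.
  by rewrite /f; case: eqP => // <- _; rewrite set21.
rewrite def_e !inE => /orP[]/eqP Ex.
  by exists b; rewrite ?inE /f Ex ?ab // def_e eqxx.
by exists a; rewrite ?inE /f Ex 1?adj_sym ?ab // def_e setUC eqxx.
Qed.

Lemma deg_subdivide_new (G : sgraph) (e : {set G}) :
  e \in edges G -> deg (None : subdivide e) = 2.
Proof.
case/edgeP=> a [b [ab def_e]].
have -> : 2 = #|e|.
  by rewrite def_e cards2; case: eqP ab => // ->; rewrite adj_irr.
rewrite /deg -(card_imset e (@Some_inj _)).
apply/eq_card=> -[z|]; rewrite inE /=.
  by rewrite mem_imset //; apply: Some_inj.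
by apply/esym/negbTE/imsetP; case.
Qed.

Section SubdividedEdge.
Variables (G : sgraph) (e : {set G}).

Definition old_part (D : {set subdivide e}) : {set G} := [set x | Some x \in D].

Lemma card_old_part (D : {set subdivide e}) :
  #|D| = (None \in D) + #|old_part D|.
Proof.
rewrite (cardsD1 None) -(card_imset (old_part D) (@Some_inj _)); congr (_ + _).
apply/eq_card=> -[z|]; rewrite !inE /=.
  by rewrite mem_imset ?inE //; apply: Some_inj.
by apply/esym/negbTE/imsetP; case.
Qed.

Hypothesis he : e \in edges G.

Lemma strong_dominating_old_part (D : {set subdivide e}) :
  strong_dominating D -> None \notin D -> strong_dominating (old_part D).
Proof.
move=> /strong_dominatingP domD wD; apply/strong_dominatingP=> x.
rewrite inE => /domD[[y|] [yD xy]]; last by rewrite yD in wD.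
rewrite !deg_subdivide_old // => le_xy.
by exists y; rewrite inE; case/andP: xy.
Qed.

(** The endpoint of larger degree does in [G] all that the new vertex does. *)
Lemma strong_dominating_trade_new (D : {set subdivide e}) (u v : G) :
  adj u v -> e = [set u; v] -> deg u <= deg v ->
  strong_dominating D -> strong_dominating (v |: old_part D).
Proof.
move=> uv def_e le_uv /strong_dominatingP domD; apply/strong_dominatingP=> x.
rewrite !inE negb_or => /andP[xv] /domD[[y|] [yD xy]].
  rewrite !deg_subdivide_old // => le_xy.
  by exists y; rewrite !inE yD orbT; case/andP: xy.
move: xy => /=; rewrite def_e !inE (negPf xv) orbF => /eqP -> _.
by exists v; rewrite setU11.
Qed.

Lemma gamma_st_le_subdivide : gamma_st G <= gamma_st (subdivide e).
Proof.
have [D domD <-] := gamma_st_attained (subdivide e).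
have [u [v [uv def_e le_uv]]] := edge_deg_ordered he.
rewrite card_old_part; case: (boolP (None \in D)) => wD.
  apply: leq_trans
    (gamma_st_le (strong_dominating_trade_new uv def_e le_uv domD)) _.
  by rewrite cardsU1 leq_add2r leq_b1.
exact/gamma_st_le/strong_dominating_old_part.
Qed.

(** An endpoint dominated along [e] is at most as large as its dominator, so
    the new vertex, of degree 2, can take over. *)
Lemma strong_dominating_add_new (D : {set G}) :
  {in e, forall y, y \in D -> deg y <= 2} ->
  strong_dominating D ->
  strong_dominating (None |: Some @: D : {set subdivide e}).
Proof.
move=> small_e /strong_dominatingP domD; apply/strong_dominatingP=> -[x|].
  rewrite !inE /= mem_imset; last exact: Some_inj.
  move=> xD; have [y [yD xy le_xy]] := domD x xD.
  have [xy_e|xy_e] := eqVneq [set x; y] e.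
    exists None; rewrite setU11 deg_subdivide_old // deg_subdivide_new //=.
    by rewrite -{1}xy_e set21 (leq_trans le_xy) // small_e // -xy_e set22.
  exists (Some y); rewrite !deg_subdivide_old //= xy xy_e !inE /=.
  by rewrite mem_imset //; apply: Some_inj.
by rewrite setU11.
Qed.

(** With [x] added, no vertex needs [e] any more, and [y] dominates the new
    vertex because its degree is at least 2. *)
Lemma strong_dominating_add_endpoint (D : {set G}) (x y : G) :
  [set x; y] = e -> y \in D -> 2 <= deg y ->
  strong_dominating D ->
  strong_dominating (Some @: (x |: D) : {set subdivide e}).
Proof.
move=> xy_e yD y_ge2 /strong_dominatingP domD; apply/strong_dominatingP=> -[z|].
  rewrite mem_imset; last exact: Some_inj.
  rewrite !inE negb_or => /andP[zx zD]; have [t [tD zt le_zt]] := domD z zD.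
  exists (Some t); rewrite !deg_subdivide_old //= zt imset_f ?setU1r //.
  split=> //; apply: contraNneq zD => zt_e.
  have: z \in [set x; y] by rewrite xy_e -zt_e set21.
  by rewrite !inE (negPf zx) => /eqP->.
move=> _; exists (Some y).
by rewrite deg_subdivide_old // deg_subdivide_new //= -xy_e set22 imset_f ?setU1r.
Qed.

Lemma gamma_st_subdivide_le : gamma_st (subdivide e) <= gamma_st G + 1.
Proof.
have [D domD <-] := gamma_st_attained G; rewrite addn1.
case: (boolP [forall y in e, (y \in D) ==> (deg y <= 2)]).
  move=> /forall_inP small_e.
  have {}small_e : {in e, forall y, y \in D -> deg y <= 2}.
    by move=> y /small_e /implyP.
  apply: leq_trans (gamma_st_le (strong_dominating_add_new small_e domD)) _.
  by rewrite cardsU1 (card_imset _ (@Some_inj _)) -add1n leq_add2r leq_b1.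
case/forall_inPn=> y ye; rewrite negb_imply -ltnNge => /andP[yD /ltnW y_ge2].
have [x xy_e] : exists x, [set x; y] = e.
  have [a [b [_ def_e]]] := edgeP he; move: ye; rewrite def_e !inE.
  by case/orP=> /eqP->; [exists b; rewrite setUC | exists a].
apply: leq_trans
  (gamma_st_le (strong_dominating_add_endpoint xy_e yD y_ge2 domD)) _.
by rewrite (card_imset _ (@Some_inj _)) cardsU1 -add1n leq_add2r leq_b1.
Qed.

End SubdividedEdge.

Theorem theorem2p5 (G : sgraph) (hG : connected G) (e : {set G})
    (he : e \in edges G) :
  gamma_st G <= gamma_st (subdivide e) /\
  gamma_st (subdivide e) <= gamma_st G + 1.
Proof.
by split; [exact: gamma_st_le_subdivide | exact: gamma_st_subdivide_le].
Qed.
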